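(* Let $G\subset\mathbb{Z}^d$ generate the positive affine monoid $M\subset\mathbb{Z}^d$, let $C\subset\mathbb{R}^d$ be the cone generated by $M$, let $\widetilde M=C\cap\mathbb{Z}^d$, and let $\Sigma$ be a triangulation of $C$ with rays in $G$. Then the union $H$ of the sets $\operatorname{par}(\sigma)\cap\mathbb{Z}^d$, $\sigma\in\Sigma$, generates the module $\widetilde M$ over $M$. Moreover, an element $y\in H$ belongs to the minimal generating set of the $M$-module $\widetilde M$ if and only if $y-x\notin C$ for all $x\in G$, $x\ne 0$.
   Context: An affine monoid is a finitely generated submonoid of $\mathbb{Z}^d$. It is positive if $x\in M$ and $-x\in M$ imply $x=0$. A triangulation of $C$ with rays in $G$ is a finite set of simplicial cones of dimension $\dim C$ whose union is $C$, any two of which intersect in a common face, and each of which comes with linearly independent generators belonging to $G$. For a simplicial cone $\sigma$ with linearly independent generators $v_1,\dots,v_k$ (where $k=\dim C$), $\operatorname{par}(\sigma)=\operatorname{par}(v_1,\dots,v_k)=\{a_1v_1+\dots+a_kv_k : 0\le a_i<1,\ i=1,\dots,k\}$. The set $\widetilde M$ is a module over $M$ via $M\times\widetilde M\to\widetilde M$, $(x,y)\mapsto x+y$. A subset $Y\subset\widetilde M$ generates $\widetilde M$ as an $M$-module if $\widetilde M=\bigcup_{y\in Y}(y+M)$. Since $M$ is positive, there is a unique minimal generating set of $\widetilde M$ over $M$. *)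

(* Defs.v *)
From HB Require Import structures.
From mathcomp Require Import all_boot all_order all_algebra.
From mathcomp Require Import boolp classical_sets functions cardinality reals.

Set Implicit Arguments.
Unset Strict Implicit.
Unset Printing Implicit Defensive.

Import Order.TTheory GRing.Theory Num.Theory.

Local Open Scope classical_set_scope.
Local Open Scope ring_scope.

Section Monoids.
Variable d : nat.
Implicit Types (G M N Y : set 'rV[int]_d).

Definition is_submonoid M : Prop :=
  M 0 /\ forall x y, M x -> M y -> M (x + y).

Definition monoid_gen G : set 'rV[int]_d := smallest is_submonoid G.

Definition affine_monoid M : Prop :=
  is_submonoid M /\ exists2 F, finite_set F & M = monoid_gen F.

Definition positive_monoid M : Prop :=
  forall x, M x -> M (- x) -> x = 0.

Definition module_generates M N Y : Prop :=
  Y `<=` N /\ N = \bigcup_(y in Y) [set y + x | x in M].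

(* Minimality is with respect to inclusion. *)
Definition minimal_generating_set M N Y : Prop :=
  module_generates M N Y /\
  forall Y', Y' `<=` Y -> module_generates M N Y' -> Y' = Y.

End Monoids.

Section Cones.
Variables (R : realType) (d : nat).
Implicit Types (A C F : set 'rV[R]_d) (V W : {vspace 'rV[R]_d}).

Definition toR (x : 'rV[int]_d) : 'rV[R]_d := map_mx intr x.

Definition lattice_points A : set 'rV[int]_d := toR @^-1` A.

Definition cone A : set 'rV[R]_d :=
  [set y | exists n (x : 'I_n -> 'rV[R]_d) (a : 'I_n -> R),
     [/\ forall i, A (x i), forall i, 0 <= a i & y = \sum_i a i *: x i]].

Definition is_linear_span A V : Prop :=
  A `<=` [set` V] /\ forall W, A `<=` [set` W] -> (V <= W)%VS.

(* [A] may be infinite, so [span] does not apply; [linear_spanP] below shows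
   that the default value is never used. *)
Definition linear_span A : {vspace 'rV[R]_d} := xget 0%VS (is_linear_span A).

Definition cone_dim C : nat := \dim (linear_span C).

(* The linear form is x |-> x *m l; l = 0 gives the improper face C. The empty
   set is not a face. *)
Definition is_face F C : Prop :=
  exists l : 'cV[R]_d,
    (forall x, C x -> 0 <= (x *m l) 0 0) /\
    F = [set x | C x /\ (x *m l) 0 0 = 0].

Definition par (s : seq 'rV[int]_d) : set 'rV[R]_d :=
  [set x | exists a : 'I_(size s) -> R,
     (forall i, 0 <= a i < 1) /\ x = \sum_i a i *: toR s`_i].

Definition simplicial_cone_on (s : seq 'rV[int]_d) C : Prop :=
  free (map toR s) /\ C = cone [set` map toR s].

(* [gens] is the choice of generators with which the cones in [Sigma] come; its
   values outside [Sigma] are irrelevant. *)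
Definition triangulation (G : set 'rV[int]_d) C (Sigma : set (set 'rV[R]_d))
    (gens : set 'rV[R]_d -> seq 'rV[int]_d) : Prop :=
  [/\ finite_set Sigma,
      forall s, Sigma s ->
        [/\ simplicial_cone_on (gens s) s, [set` gens s] `<=` G
          & cone_dim s = cone_dim C],
      \bigcup_(s in Sigma) s = C
    & forall s t, Sigma s -> Sigma t ->
        is_face (s `&` t) s /\ is_face (s `&` t) t].

Lemma linear_spanP A : is_linear_span A (linear_span A).
Proof.
rewrite /linear_span; case: xgetP => // nospan.
pose P k := `[< exists2 X : seq 'rV[R]_d,
                  [set` X] `<=` A & \dim <<X>>%VS = k >].
have exP : exists k, P k.
  by exists (\dim (<<[::] : seq 'rV[R]_d>>)%VS); apply/asboolP; exists [::].
have leP k : P k -> (k <= \dim {: 'rV[R]_d})%N.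
  by move=> /asboolP[X _ <-]; apply/dimvS/subvf.
case: (ex_maxnP exP leP) => k /asboolP[X XA dX] maxk.
case: (nospan <<X>>%VS); split=> [x Ax /=|W AW]; last first.
  by apply/span_subvP => x Xx; apply: AW; apply: XA.
have sXxX : (<<X>> <= <<x :: X>>)%VS by rewrite span_cons addvSr.
have: (<<X>> == <<x :: X>>)%VS.
  rewrite eqEdim sXxX dX; apply/maxk/asboolP; exists (x :: X) => // y /=.
  by rewrite inE => /predU1P[->//|/XA].
by move=> /eqP ->; rewrite memv_span ?mem_head.
Qed.

End Cones.

Arguments toR R {d} x.
Arguments par R {d} s.

Definition monoid_cone (R : realType) (d : nat) (M : set 'rV[int]_d) :
  set 'rV[R]_d := cone (toR R @` M).

Arguments monoid_cone R {d} M.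

Definition saturation (R : realType) (d : nat) (M : set 'rV[int]_d) :
  set 'rV[int]_d := lattice_points (monoid_cone R M).

Arguments saturation R {d} M.

(* Main.v *)
Require Import Defs.
From HB Require Import structures.
From mathcomp Require Import all_boot all_order all_algebra.
From mathcomp Require Import boolp classical_sets functions cardinality reals.
From mathcomp Require Import zify.

(** Write N for the lattice points of the cone C of M.

    That H generates N is the usual rounding argument: a lattice point y of C
    lies in some cone of the triangulation, hence is a nonnegative combination
    of generators v_i taken from G; subtracting the integral parts of the
    coefficients removes an element of M and leaves a lattice point of the
    half-open parallelotope ([cone_par_decomposition],
    [triangulation_par_generates]).

    The minimal generating set is described intrinsically, as the set of
    irreducible elements: those y in N from which no nonzero x in M can be
    subtracted without leaving N. An irreducible y = z + x, with z a generator
    and x in M, forces x = 0, so every generating set contains all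
    irreducibles. It remains to see that the irreducibles generate. The set H
    is finite, because a parallelotope is bounded, and positivity of M says
    that u <= v iff v - u lies in M is a partial order; so every element of H
    lies above a minimal one. A minimal element y of H is irreducible: if
    y - x = h + m with h in H and x, m in M, then h <= y, so h = y, thus
    - x = m lies in M, and x = 0 by positivity ([irreducibles_generate]).
    Consequently the irreducibles form the only minimal generating set
    ([minimal_generating_setE]).

    For the last claim, irreducibility has to be tested only against the
    nonzero elements of G. Any nonzero x in M is g + x' with g in G nonzero
    and x' in M, so if y - x lies in C then so does y - g = (y - x) + x'
    ([monoid_gen_split], [irreducible_saturationP]). *)

Set Implicit Arguments.
Unset Strict Implicit.
Unset Printing Implicit Defensive.

Import Order.TTheory GRing.Theory Num.Theory.

Local Open Scope classical_set_scope.
Local Open Scope ring_scope.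

(** * Minimal generators of modules over positive monoids *)

Lemma monoid_gen_submonoid d (G : set 'rV[int]_d) : is_submonoid (monoid_gen G).
Proof.
split=> [X [[X0 _] _] //|x y Mx My X sX].
by case: (sX) => -[_ XD] _; apply: XD; [apply: Mx|apply: My].
Qed.

Lemma sub_monoid_gen d (G : set 'rV[int]_d) : G `<=` monoid_gen G.
Proof. by move=> x Gx X [_]; apply. Qed.

(** The elements satisfying the conclusion, together with 0, form a submonoid
    containing G, so no explicit sums of elements of G are needed. In a sum
    y + z, the generator is split off y unless y = 0. *)
Lemma monoid_gen_split d (G : set 'rV[int]_d) x : monoid_gen G x -> x <> 0 ->
  exists g, [/\ G g, g <> 0 & monoid_gen G (x - g)].
Proof.
have [M0 MD] := monoid_gen_submonoid G.
pose X := [set x | monoid_gen G x /\ (x <> 0 ->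
  exists g, [/\ G g, g <> 0 & monoid_gen G (x - g)])].
suff sGX : monoid_gen G `<=` X by move=> /sGX[].
apply: smallest_sub => [|g Gg]; last first.
  by split=> [|g0]; [exact: sub_monoid_gen|exists g; rewrite subrr].
split=> [|y z [My gy] [Mz gz]]; first by split.
split=> [|yz0]; first exact: MD.
have [y0|/eqP/gy[g [Gg g0 Myg]]] := eqVneq y 0.
  by move: yz0; rewrite y0 add0r.
by exists g; split; rewrite // addrAC; apply: MD.
Qed.

Definition module_irreducibles d (M N : set 'rV[int]_d) : set 'rV[int]_d :=
  [set y | N y /\ forall x, M x -> x <> 0 -> ~ N (y - x)].

(** Writing an irreducible y as z + x, with z a generator, leaves x = 0 as the
    only possibility. *)
Lemma irreducibles_sub_generators d (M N Y : set 'rV[int]_d) :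
  module_generates M N Y -> module_irreducibles M N `<=` Y.
Proof.
move=> [YN NE] y [Ny irr_y]; move: (Ny); rewrite NE => -[z Yz [x Mx yE]].
have [x0|/eqP x0] := eqVneq x 0; first by rewrite -yE x0 addr0.
by case: (irr_y x Mx x0); rewrite -yE addrK; apply: YN.
Qed.

(** Stated for x :: s with x arbitrary, so that the induction hypothesis can be
    applied a second time, at the head a of the sequence, when the minimal
    element found below x turns out to lie above a. *)
Lemma minimal_in_seq (T : eqType) (le : T -> T -> Prop)
    (le_refl : forall x, le x x)
    (le_trans : forall x y z, le x y -> le y z -> le x z)
    (le_anti : forall x y, le x y -> le y x -> x = y) (s : seq T) x :
  exists2 y, y \in x :: s & le y x /\ forall z, z \in s -> le z y -> z = y.
Proof.
elim: s x => [|a s IHs] x; first by exists x; rewrite ?mem_head.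
have [y ys [yx ymin]] := IHs x.
have [ay|nay] := pselect (le a y); last first.
  exists y; first by move: ys; rewrite !inE => /orP[]->; rewrite ?orbT.
  by split=> // z; rewrite inE => /predU1P[->|/ymin].
have [t ts [ta tmin]] := IHs a.
exists t; first by rewrite inE ts orbT.
split=> [|z]; first exact: le_trans ta (le_trans _ _ _ ay yx).
by rewrite inE => /predU1P[-> at_|/tmin//]; apply: le_anti.
Qed.

(** The minimal elements of a finite generating set, for the order in which
    u <= v means that v - u is in M, are irreducible, and every generator lies
    above one of them. Positivity serves twice: as antisymmetry of this order
    and to conclude that x = 0 when both x and - x are in M. *)
Lemma irreducibles_generate d (M N Y : set 'rV[int]_d) :
  is_submonoid M -> positive_monoid M -> finite_set Y ->
  module_generates M N Y -> module_generates M N (module_irreducibles M N).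
Proof.
move=> [M0 MD] Mpos /finite_seqP[s Ys] [YN NE]; split=> [y []//|].
rewrite eqEsubset; split=> [n|n [y [Ny _] [x Mx <-]]]; last first.
  move: Ny; rewrite NE => -[z Yz [x' Mx' <-]].
  by exists z => //; exists (x' + x); rewrite ?addrA//; apply: MD.
rewrite {1}NE => -[y Yy [x Mx <-]].
have [|||z zs [zy zmin]] :=
    @minimal_in_seq _ (fun u v : 'rV[int]_d => M (v - u)) _ _ _ s y.
- by move=> u; rewrite subrr.
- by move=> u v w Mvu Mwv; rewrite -(subrKA v); apply: MD.
- move=> u v Mvu Muv; apply/esym/eqP; rewrite -subr_eq0; apply/eqP.
  by apply: Mpos => //; rewrite opprB.
(* z is minimal in Y below y; it generates y + x and is irreducible. *)
have Yz : Y z.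
  by move: zs Yy; rewrite inE Ys => /predU1P[->|].
exists z; last first.
  by exists (y - z + x); [exact: MD|rewrite addrA addrC subrKC addrC].
split=> [|t Mt t0]; first exact: YN.
rewrite NE => -[w Yw [m Mm wm]]; apply: t0; apply: Mpos => //.
have zE : z = w + (m + t) by rewrite addrA wm subrK.
have wz : w = z.
  by apply: zmin; [move: Yw; rewrite Ys|rewrite {1}zE addrC addKr; apply: MD].
suff -> : - t = m by [].
by apply: (addrI z); rewrite -wm wz.
Qed.

Lemma minimal_generating_setE d (M N Y0 : set 'rV[int]_d) :
  is_submonoid M -> positive_monoid M -> finite_set Y0 ->
  module_generates M N Y0 -> forall Y,
  minimal_generating_set M N Y <-> Y = module_irreducibles M N.
Proof.
move=> Msub Mpos Yfin Ygen Y.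
have irrgen := irreducibles_generate Msub Mpos Yfin Ygen.
split=> [[genY minY]|->].
  by apply/esym/minY => //; exact: irreducibles_sub_generators.
split=> // Y' Y'irr genY'; apply/seteqP; split=> //.
exact: irreducibles_sub_generators.
Qed.

(** * Cones, parallelotopes and their lattice points *)

Section ToR.
Variables (R : realType) (d : nat).
Implicit Types (x y : 'rV[int]_d) (A : set 'rV[R]_d).

Lemma toRD x y : toR R (x + y) = toR R x + toR R y.
Proof. by rewrite /toR map_mxD. Qed.

Lemma toRB x y : toR R (x - y) = toR R x - toR R y.
Proof. by rewrite /toR map_mxB. Qed.

Lemma toR_sumZ (I : finType) (m : I -> int) (v : I -> 'rV[int]_d) :
  toR R (\sum_i m i *: v i) = \sum_i (m i)%:~R *: toR R (v i).
Proof.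
by rewrite /toR map_mx_sum; apply: eq_bigr => i _; rewrite map_mxZ.
Qed.

Lemma sub_cone A : A `<=` cone A.
Proof.
by move=> x Ax; exists 1%N, (fun=> x), (fun=> 1); rewrite big_ord1 scale1r.
Qed.

Lemma coneD A (x y : 'rV[R]_d) : cone A x -> cone A y -> cone A (x + y).
Proof.
move=> [n [u [a [Au a0 ->]]]] [m [v [b [Av b0 ->]]]].
pose w T (f : 'I_n -> T) (g : 'I_m -> T) (i : 'I_(n + m)) :=
  match fintype.split i with inl j => f j | inr k => g k end.
exists (n + m)%N, (w _ u v), (w _ a b); split.
- by move=> i; rewrite /w; case: fintype.split.
- by move=> i; rewrite /w; case: fintype.split.
rewrite big_split_ord /w; congr (_ + _); apply: eq_bigr => i _.
  by rewrite (unsplitK (inl i)).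
by rewrite (unsplitK (inr i)).
Qed.

(** An element of a cone is a combination of arbitrarily many, possibly
    repeated, generators; over a finite list these can be regrouped into one
    coefficient per entry. *)
Lemma cone_seqP (s : seq 'rV[int]_d) (y : 'rV[R]_d) :
  cone [set` map (toR R) s] y <->
  exists2 a : 'I_(size s) -> R, forall i, 0 <= a i &
    y = \sum_i a i *: toR R s`_i.
Proof.
split=> [[n [x [a [sx a0 ->]]]]|[a a0 ->]]; last first.
  exists (size s), (fun i => toR R s`_i), a; split=> // i.
  by apply: map_f; apply: mem_nth.
elim/big_ind: _ => [|u v [b b0 ->] [c c0 ->]|i _].
- by exists (fun=> 0) => //; rewrite big1 // => i _; rewrite scale0r.
- exists (fun i => b i + c i) => [i|]; first exact: addr_ge0.
  by rewrite -big_split; apply: eq_bigr => i _; rewrite scalerDl.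
have /mapP[v vs ->] := sx i.
have vi : (index v s < size s)%N by rewrite index_mem.
exists (fun j => if j == Ordinal vi then a i else 0) => [j|].
  by case: ifP.
rewrite (bigD1 (Ordinal vi)) //= eqxx nth_index // big1 ?addr0 // => j.
by move=> /negPf ->; rewrite scale0r.
Qed.

Lemma par_sub_cone (s : seq 'rV[int]_d) :
  par R s `<=` cone [set` map (toR R) s].
Proof.
move=> x [a [a01 ->]]; apply/cone_seqP; exists a => // i.
by case/andP: (a01 i).
Qed.

(** Rounding down the coefficients of y leaves fractional parts, which lie in
    [0, 1). *)
Lemma cone_par_decomposition (s : seq 'rV[int]_d) y :
  cone [set` map (toR R) s] (toR R y) ->
  exists m : 'I_(size s) -> nat,
    lattice_points (par R s) (y - \sum_(i < size s) s`_i *+ m i).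
Proof.
move=> /cone_seqP[a a0 yE]; exists (fun i => Num.truncn (a i)).
exists (fun i => a i - (Num.truncn (a i))%:R); split=> [i|].
  have /andP[lea alt] := truncn_itv (a0 i).
  by rewrite subr_ge0 lea ltrBlDl natr1 alt.
under eq_bigr do rewrite -scaler_nat natz.
rewrite toRB toR_sumZ yE -sumrB; apply: eq_bigr => i _.
by rewrite scalerBl.
Qed.

Lemma finite_box (B : nat) :
  finite_set [set y : 'rV[int]_d | forall j, (`|y 0%R j| <= B)%N].
Proof.
pose f (z : 'rV['I_(B + B).+1]_d) : 'rV[int]_d :=
  \row_j ((z 0 j : nat)%:Z - B%:Z).
apply: (@sub_finite_set _ _ (f @` setT)); last exact/finite_image/finite_finset.
move=> y /= yB; exists (\row_(j < d) inord (absz (y 0 j + B%:Z))) => //.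
apply/rowP=> j; rewrite !mxE; have := yB j => yBj.
rewrite inordK; first lia.
lia.
Qed.

(** Coefficients in [0, 1) bound each coordinate by the sum of the absolute
    values of the generators' coordinates. *)
Lemma finite_lattice_points_par (s : seq 'rV[int]_d) :
  finite_set (lattice_points (par R s)).
Proof.
pose b (j : 'I_d) := (\sum_(i < size s) absz ((s`_i)%R 0%R j))%N.
apply: sub_finite_set (finite_box (\sum_j b j)%N) => y [a [a01 yE]] j.
apply: (@leq_trans (b j)); last by rewrite (bigD1 j) //= leq_addr.
have /rowP/(_ j) := yE; rewrite mxE summxE => yjE.
rewrite -(ler_nat R) natr_absz intr_norm yjE /b natr_sum.
apply: le_trans (ler_norm_sum _ _ _) _; apply: ler_sum => i _.
have /andP[ai0 ai1] := a01 i.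
rewrite !mxE normrM ger0_norm // natr_absz intr_norm.
by rewrite ler_piMl // ltW.
Qed.

End ToR.

(** * Generators of the saturation *)

Section Saturation.
Variables (R : realType) (d : nat).

Lemma sub_saturation (M : set 'rV[int]_d) : M `<=` saturation R M.
Proof. by move=> x Mx; apply: sub_cone; exists x. Qed.

Lemma saturationD (M : set 'rV[int]_d) x y :
  saturation R M x -> saturation R M y -> saturation R M (x + y).
Proof. by rewrite /saturation /lattice_points /= toRD; exact: coneD. Qed.

Lemma triangulation_par_generates (G : set 'rV[int]_d)
    (Sigma : set (set 'rV[R]_d)) (gens : set 'rV[R]_d -> seq 'rV[int]_d) :
  triangulation G (monoid_cone R (monoid_gen G)) Sigma gens ->
  module_generates (monoid_gen G) (saturation R (monoid_gen G))
    (\bigcup_(s in Sigma) lattice_points (par R (gens s))).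
Proof.
have [M0 MD] := monoid_gen_submonoid G.
move=> [_ simp cover _].
have HN : \bigcup_(s in Sigma) lattice_points (par R (gens s)) `<=`
    saturation R (monoid_gen G).
  move=> y [s Ss ys]; rewrite /saturation /lattice_points /= -cover.
  exists s => //; have [[_ ->] _ _] := simp s Ss; exact: par_sub_cone.
split=> //; apply/seteqP; split=> [y|y [h Hh [x Mx <-]]]; last first.
  exact: saturationD (HN _ Hh) (sub_saturation _).
rewrite /saturation /lattice_points /= -cover => -[s Ss ys].
have [[_ sE] sG _] := simp s Ss.
move: ys; rewrite {1}sE => /cone_par_decomposition[m parm].
eexists; first by exists s; [|exact: parm].
exists (\sum_(i < size (gens s)) (gens s)`_i *+ m i); last exact: subrK.
apply: big_ind => // i _; elim: (m i) => [|k IHk]; first by rewrite mulr0n.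
rewrite mulrS; apply: MD => //; apply: sub_monoid_gen; apply: sG.
exact: mem_nth.
Qed.

(** A nonzero x in M with y - x in the cone can be replaced by a generator g
    split off x, since adding x - g back stays in the cone. *)
Lemma irreducible_saturationP (G : set 'rV[int]_d) y :
  saturation R (monoid_gen G) y ->
  module_irreducibles (monoid_gen G) (saturation R (monoid_gen G)) y <->
  forall x, G x -> x <> 0 -> ~ saturation R (monoid_gen G) (y - x).
Proof.
move=> Ny; split=> [[_ irr] x /sub_monoid_gen|irrG]; first exact: irr.
split=> // x Mx x0 Nyx; have [g [Gg g0 Mxg]] := monoid_gen_split Mx x0.
apply: (irrG g Gg g0); rewrite -(subrKA x).
exact: saturationD (sub_saturation Mxg).
Qed.

End Saturation.

Theorem proposition14 (R : realType) (d : nat) (G M : set 'rV[int]_d)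
    (Sigma : set (set 'rV[R]_d)) (gens : set 'rV[R]_d -> seq 'rV[int]_d)
    (M_affine : affine_monoid M) (M_positive : positive_monoid M)
    (G_gen : monoid_gen G = M)
    (Sigma_tri : triangulation G (monoid_cone R M) Sigma gens) :
  let H := \bigcup_(s in Sigma) lattice_points (par R (gens s)) in
  [/\ module_generates M (saturation R M) H,
      exists! Y, minimal_generating_set M (saturation R M) Y
    & forall Y, minimal_generating_set M (saturation R M) Y ->
        forall y, H y ->
          (Y y <-> forall x, G x -> x <> 0 ->
                     ~ monoid_cone R M (toR R (y - x)))].
Proof.
move=> H; subst M.
have genH := triangulation_par_generates Sigma_tri.
have finH : finite_set H.
  case: Sigma_tri => finS _ _ _; apply: bigcup_finite => // s _.
  exact: finite_lattice_points_par.
have minE :=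
  minimal_generating_setE (monoid_gen_submonoid G) M_positive finH genH.
split=> //.
  exists (module_irreducibles (monoid_gen G) (saturation R (monoid_gen G))).
  by split=> [|Y /minE ->//]; apply/minE.
move=> Y /minE -> y Hy; apply: irreducible_saturationP.
by case: genH => HN _; apply: HN.
Qed.
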